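(* Let $L$ be the virtual Hopf link, i.e. the closure of the virtual braid $\sigma_1^{-1}\rho_1\in VB_2$. Then the groups $G_A(L)$ and $G_{\tilde M}(L)$ are right-angled Artin groups, and $G_A(L)$ is not isomorphic to $G_{\tilde M}(L)$.
   Context: Conjugation: $x^{y}=y^{-1}xy$. $VB_2$ is generated by $\sigma_1,\rho_1$ with the relation $\rho_1^2=1$. In both representations below, automorphisms act on the right (in a braid word the automorphism of the leftmost letter is applied first). The representation $\varphi_A:VB_2\to\operatorname{Aut}(\langle x_1,x_2,y\rangle)$ (automorphisms of the free group of rank 3) is: $\varphi_A(\sigma_1): x_1\mapsto x_1x_2x_1^{-1},\ x_2\mapsto x_1,\ y\mapsto y$; $\varphi_A(\rho_1): x_1\mapsto x_2^{y^{-1}},\ x_2\mapsto x_1^{y},\ y\mapsto y$. For $L$ the closure of $\beta\in VB_2$, $G_A(L)=\langle x_1,x_2,y\mid x_i=\varphi_A(\beta)(x_i),\ i=1,2\rangle$. Let $F_{2,2}=F_2\ast\mathbb{Z}^2$ with $F_2=\langle y_1,y_2\rangle$ free and $\mathbb{Z}^2=\langle v_1,v_2\rangle$ free abelian. The representation $\tilde\varphi_M:VB_2\to\operatorname{Aut}(F_{2,2})$ is: $\tilde\varphi_M(\sigma_1): y_1\mapsto y_1y_2y_1^{-1},\ y_2\mapsto y_1,\ v_1\mapsto v_2,\ v_2\mapsto v_1$; $\tilde\varphi_M(\rho_1): y_1\mapsto y_2^{v_1^{-1}},\ y_2\mapsto y_1^{v_2},\ v_1\mapsto v_2,\ v_2\mapsto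 v_1$. For $L$ the closure of $\beta\in VB_2$, $G_{\tilde M}(L)=\langle y_1,y_2,v_1,v_2\mid [v_1,v_2]=1,\ y_i=\tilde\varphi_M(\beta)(y_i),\ v_i=\tilde\varphi_M(\beta)(v_i),\ i=1,2\rangle$. A right-angled Artin group is a group with a presentation by finitely many generators in which all relations are commutations $[s,t]=1$ between some pairs of generators. *)

(* Defs.v *)
From HB Require Import structures.
From mathcomp Require Import all_boot generic_quotient boolp.

Set Implicit Arguments.
Unset Strict Implicit.
Unset Printing Implicit Defensive.

Local Open Scope group_scope.
Local Open Scope quotient_scope.

Definition isomorphic (G H : groupType) : Prop :=
  exists f : {multiplicative G -> H}, bijective f.

(* The letter (x, false) is x and (x, true) is its inverse. *)
Definition word (X : Type) : Type := seq (X * bool).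

HB.instance Definition _ (X : Type) := gen_eqMixin (word X).
HB.instance Definition _ (X : Type) := gen_choiceMixin (word X).

Section FreeGroup.
Variable X : Type.
Implicit Types u v w : word X.

Inductive free_eq : word X -> word X -> Prop :=
| free_refl u : free_eq u u
| free_sym u v : free_eq u v -> free_eq v u
| free_trans u v w : free_eq u v -> free_eq v w -> free_eq u w
| free_cancel u v x b : free_eq (u ++ (x, b) :: (x, ~~ b) :: v) (u ++ v).

Definition free_rel : rel (word X) := fun u v => `[< free_eq u v >].

Lemma free_rel_refl : reflexive free_rel.
Proof. by move=> u; apply/asboolP; apply: free_refl. Qed.
Lemma free_rel_sym : symmetric free_rel.
Proof. by move=> u v; apply/asboolP/asboolP; apply: free_sym. Qed.
Lemma free_rel_trans : transitive free_rel.
Proof.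
by move=> v u w /asboolP uv /asboolP vw; apply/asboolP; apply: free_trans uv vw.
Qed.

Canonical free_equiv :=
  EquivRel free_rel free_rel_refl free_rel_sym free_rel_trans.

Definition free_group : Type := {eq_quot free_rel}.
HB.instance Definition _ := Choice.on free_group.
HB.instance Definition _ := EqQuotient.on free_group.

Lemma free_piP u v : \pi_free_group u = \pi_free_group v <-> free_eq u v.
Proof. by split=> [/eqmodP/asboolP|uv] //; apply/eqmodP/asboolP. Qed.

Definition word_inv u : word X := [seq (l.1, ~~ l.2) | l <- rev u].

Definition free_one : free_group := \pi_free_group [::].
Definition free_mul (a b : free_group) : free_group := \pi_free_group (repr a ++ repr b).
Definition free_inv (a : free_group) : free_group := \pi_free_group (word_inv (repr a)).

Lemma free_eq_cat u u' v v' :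
  free_eq u u' -> free_eq v v' -> free_eq (u ++ v) (u' ++ v').
Proof.
move=> uu' vv'; apply: (@free_trans _ (u' ++ v)).
  elim: uu' => {u u'} [u|u u' _|u u' u'' _ + _|u w x b].
  - exact: free_refl.
  - exact: free_sym.
  - exact: free_trans.
  - by rewrite -!catA /=; apply: free_cancel.
elim: vv' => {v v'} [v|v v' _|v v' v'' _ + _|v w x b].
- exact: free_refl.
- exact: free_sym.
- exact: free_trans.
- by rewrite !catA; apply: free_cancel.
Qed.

Lemma free_eq_inv u v : free_eq u v -> free_eq (word_inv u) (word_inv v).
Proof.
elim=> {u v} [u|u v _|u v w _ + _|u v x b].
- exact: free_refl.
- exact: free_sym.
- exact: free_trans.
- rewrite /word_inv !rev_cat !rev_cons !map_cat !map_rcons -!cats1 -!catA /=.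
  by rewrite negbK; apply: free_cancel.
Qed.

Lemma free_eq_mulVw u : free_eq (word_inv u ++ u) [::].
Proof.
elim: u => [|[x b] u IHu]; first exact: free_refl.
rewrite /word_inv rev_cons map_rcons -cats1 -catA /=.
apply: free_trans IHu; rewrite -{2}[b]negbK; exact: free_cancel.
Qed.

Lemma word_invK : involutive word_inv.
Proof.
move=> u; rewrite /word_inv -map_rev revK -map_comp -[RHS]map_id.
by apply: eq_map => -[x b] /=; rewrite negbK.
Qed.

Lemma free_eq_repr u : free_eq (repr (\pi_free_group u)) u.
Proof. by apply/free_piP; rewrite reprK. Qed.

Lemma pi_free_mul u v : free_mul (\pi_free_group u) (\pi_free_group v) = \pi_free_group (u ++ v).
Proof. by apply/free_piP/free_eq_cat; apply: free_eq_repr. Qed.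

Lemma pi_free_inv u : free_inv (\pi_free_group u) = \pi_free_group (word_inv u).
Proof. by apply/free_piP/free_eq_inv; apply: free_eq_repr. Qed.

Lemma free_quotW (P : free_group -> Prop) : (forall u, P (\pi_free_group u)) -> forall a, P a.
Proof. by move=> Ppi a; rewrite -[a]reprK. Qed.

Lemma free_mulA : associative free_mul.
Proof.
elim/free_quotW=> u; elim/free_quotW=> v; elim/free_quotW=> w.
by rewrite !pi_free_mul catA.
Qed.
Lemma free_mul1 : left_id free_one free_mul.
Proof. by elim/free_quotW=> u; rewrite pi_free_mul. Qed.
Lemma free_mulr1 : right_id free_one free_mul.
Proof. by elim/free_quotW=> u; rewrite pi_free_mul cats0. Qed.
Lemma free_mulV : left_inverse free_one free_inv free_mul.
Proof.
elim/free_quotW=> u; rewrite pi_free_inv pi_free_mul.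
by apply/free_piP/free_eq_mulVw.
Qed.
Lemma free_mulrV : right_inverse free_one free_inv free_mul.
Proof.
elim/free_quotW=> u; rewrite pi_free_inv pi_free_mul.
by apply/free_piP; rewrite -{1}[u]word_invK; apply: free_eq_mulVw.
Qed.

HB.instance Definition _ := isGroup.Build free_group
  free_mulA free_mul1 free_mulr1 free_mulV free_mulrV.

Definition gen (x : X) : free_group := \pi_free_group [:: (x, false)].

Lemma gen_inv x : (gen x)^-1 = \pi_free_group [:: (x, true)].
Proof. exact: pi_free_inv. Qed.

Lemma free_ind (P : free_group -> Prop) :
    P 1 -> (forall x a, P a -> P (gen x * a)) ->
    (forall x a, P a -> P ((gen x)^-1 * a)) -> forall a, P a.
Proof.
move=> P1 Pg PV; elim/free_quotW; elim=> // -[x b] u IHu.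
have [Pxu PVxu] := (Pg x _ IHu, PV x _ IHu).
by case: b; [move: PVxu; rewrite gen_inv|move: Pxu]; rewrite [_ * _]pi_free_mul.
Qed.

End FreeGroup.

Section FreeLift.
Variables (X : Type) (G : groupType) (f : X -> G).

Definition word_eval (u : word X) : G :=
  foldr (fun l g => (if l.2 then (f l.1)^-1 else f l.1) * g) 1 u.

Definition free_lift (a : free_group X) : G := word_eval (repr a).

Lemma word_eval_cat u v : word_eval (u ++ v) = word_eval u * word_eval v.
Proof. by elim: u => [|l u IHu] /=; rewrite ?mul1g // IHu mulgA. Qed.

Lemma word_eval_eq u v : free_eq u v -> word_eval u = word_eval v.
Proof.
elim=> {u v} // [u v w _ -> _ ->|u v x b] //.
rewrite !word_eval_cat /=; congr (_ * _).
by case: b => /=; rewrite ?mulKg ?mulVKg.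
Qed.

Lemma free_lift_pi u : free_lift (\pi_(free_group X) u) = word_eval u.
Proof. exact/word_eval_eq/free_eq_repr. Qed.

Lemma free_liftM : {morph free_lift : a b / a * b}.
Proof.
elim/free_quotW=> u; elim/free_quotW=> v.
by rewrite [_ * _]pi_free_mul !free_lift_pi word_eval_cat.
Qed.

HB.instance Definition _ :=
  isUMagmaMorphism.Build (free_group X) G free_lift
    (free_lift_pi [::], free_liftM).

Lemma free_lift_gen x : free_lift (gen x) = f x.
Proof. by rewrite free_lift_pi /= mulg1. Qed.

End FreeLift.

Lemma free_hom_ext (X : Type) (G : groupType)
    (f g : UMagmaMorphism.type (free_group X) G) :
  (forall x, f (gen x) = g (gen x)) -> f =1 g.
Proof.
move=> fg; elim/free_ind=> [|x a IHa|x a IHa]; first by rewrite !gmulf1.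
  by rewrite !gmulfM fg IHa.
by rewrite !gmulfM !gmulfV fg IHa.
Qed.

Definition normal_subgroup (G : groupType) (N : G -> Prop) : Prop :=
  [/\ N 1, forall a b, N a -> N b -> N (a * b), forall a, N a -> N a^-1
    & forall a b, N a -> N (a ^ b)].

Definition normal_closure (G : groupType) (R : G -> Prop) (a : G) : Prop :=
  forall N, normal_subgroup N -> (forall r, R r -> N r) -> N a.

Lemma normal_closure_normal (G : groupType) (R : G -> Prop) :
  normal_subgroup (normal_closure R).
Proof.
split=> [N|a b Ha Hb N|a Ha N|a b Ha N] nN RN; have [N1 NM NV NJ] := nN.
- exact: N1.
- by apply: NM; [apply: Ha|apply: Hb].
- by apply: NV; apply: Ha.
- by apply: NJ; apply: Ha.
Qed.

Lemma normal_closure_sub (G : groupType) (R : G -> Prop) r :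
  R r -> normal_closure R r.
Proof. by move=> Rr N _; apply. Qed.

Lemma normal_closure_hom (G H : groupType) (R : G -> Prop)
    (f : UMagmaMorphism.type G H) :
  (forall r, R r -> f r = 1) -> forall a, normal_closure R a -> f a = 1.
Proof.
move=> fR a Ra; apply: (Ra (fun b => f b = 1)); last exact: fR.
split=> [|b c fb fc|b fb|b c fb]; rewrite ?gmulf1 // ?gmulfJ ?gmulfM ?gmulfV.
- by rewrite fb fc mulg1.
- by rewrite fb invg1.
- by rewrite fb conj1g.
Qed.

Section Presentation.
(* [presented E] is the group <X | u = v for all u, v such that E u v>. *)
Variables (X : Type) (E : free_group X -> free_group X -> Prop).

Definition relator (r : free_group X) : Prop := exists u v, E u v /\ r = u^-1 * v.

Definition pres_rel : rel (free_group X) :=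
  fun a b => `[< normal_closure relator (a^-1 * b) >].

Lemma pres_rel_refl : reflexive pres_rel.
Proof.
have [N1 _ _ _] := normal_closure_normal relator.
by move=> a; apply/asboolP; rewrite mulVg.
Qed.
Lemma pres_rel_sym : symmetric pres_rel.
Proof.
have [_ _ NV _] := normal_closure_normal relator.
by move=> a b; apply/asboolP/asboolP => /NV; rewrite invgM invgK.
Qed.
Lemma pres_rel_trans : transitive pres_rel.
Proof.
have [_ NM _ _] := normal_closure_normal relator.
move=> b a c /asboolP ab /asboolP bc; apply/asboolP.
by have := NM _ _ ab bc; rewrite mulgA mulgK.
Qed.

Canonical pres_equiv :=
  EquivRel pres_rel pres_rel_refl pres_rel_sym pres_rel_trans.

Definition presented : Type := {eq_quot pres_rel}.
HB.instance Definition _ := Choice.on presented.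
HB.instance Definition _ := EqQuotient.on presented.

Lemma pres_piP a b :
  \pi_presented a = \pi_presented b <-> normal_closure relator (a^-1 * b).
Proof. by split=> [/eqmodP/asboolP|ab] //; apply/eqmodP/asboolP. Qed.

Lemma pres_quotW (P : presented -> Prop) :
  (forall a, P (\pi_presented a)) -> forall p, P p.
Proof. by move=> Ppi p; rewrite -[p]reprK. Qed.

Definition pres_one : presented := \pi_presented 1.
Definition pres_mul (p q : presented) : presented := \pi_presented (repr p * repr q).
Definition pres_inv (p : presented) : presented := \pi_presented (repr p)^-1.

Lemma pi_pres_mul a b : pres_mul (\pi_presented a) (\pi_presented b) = \pi_presented (a * b).
Proof.
apply/pres_piP; set a' := repr _; set b' := repr _.
have /pres_piP aN : \pi_presented a' = \pi_presented a by rewrite reprK.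
have /pres_piP bN : \pi_presented b' = \pi_presented b by rewrite reprK.
have [_ NM _ NJ] := normal_closure_normal relator.
suff -> : (a' * b')^-1 * (a * b) = (a'^-1 * a) ^ b' * (b'^-1 * b).
  by apply: NM => //; apply: NJ.
by rewrite conjgE invgM !mulgA mulgK.
Qed.

Lemma pi_pres_inv a : pres_inv (\pi_presented a) = \pi_presented a^-1.
Proof.
apply/pres_piP; set a' := repr _.
have /pres_piP aN : \pi_presented a = \pi_presented a' by rewrite reprK.
have [_ _ _ NJ] := normal_closure_normal relator.
suff -> : a'^-1^-1 * a^-1 = (a^-1 * a') ^ a^-1 by apply: NJ.
by rewrite conjgE !invgK !mulgA mulgV mul1g.
Qed.

Lemma pres_mulA : associative pres_mul.
Proof.
elim/pres_quotW=> a; elim/pres_quotW=> b; elim/pres_quotW=> c.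
by rewrite !pi_pres_mul mulgA.
Qed.
Lemma pres_mul1 : left_id pres_one pres_mul.
Proof. by elim/pres_quotW=> a; rewrite pi_pres_mul mul1g. Qed.
Lemma pres_mulr1 : right_id pres_one pres_mul.
Proof. by elim/pres_quotW=> a; rewrite pi_pres_mul mulg1. Qed.
Lemma pres_mulV : left_inverse pres_one pres_inv pres_mul.
Proof. by elim/pres_quotW=> a; rewrite pi_pres_inv pi_pres_mul mulVg. Qed.
Lemma pres_mulrV : right_inverse pres_one pres_inv pres_mul.
Proof. by elim/pres_quotW=> a; rewrite pi_pres_inv pi_pres_mul mulgV. Qed.

HB.instance Definition _ := isGroup.Build presented
  pres_mulA pres_mul1 pres_mulr1 pres_mulV pres_mulrV.

Definition pres_proj (a : free_group X) : presented := \pi_presented a.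

Lemma pres_projM : {morph pres_proj : a b / a * b}.
Proof. by move=> a b; rewrite [RHS]pi_pres_mul. Qed.

HB.instance Definition _ := isUMagmaMorphism.Build (free_group X) presented pres_proj
  (erefl, pres_projM).

Definition pgen (x : X) : presented := pres_proj (gen x).

Lemma pres_projE u v : E u v -> pres_proj u = pres_proj v.
Proof. by move=> Euv; apply/pres_piP; apply: normal_closure_sub; exists u, v. Qed.

End Presentation.

Section PresLift.
Variables (X : Type) (E : free_group X -> free_group X -> Prop) (G : groupType).
Variable f : X -> G.

Definition respects : Prop :=
  forall u v, E u v -> free_lift f u = free_lift f v.

Definition pres_lift of respects :=
  fun p : presented E => free_lift f (repr p).

Hypothesis fE : respects.

Lemma pres_lift_pi a : pres_lift fE (pres_proj E a) = free_lift f a.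
Proof.
have /pres_piP : \pi_(presented E) (repr (pres_proj E a)) = \pi_(presented E) a.
  by rewrite reprK.
have relf r : relator E r -> free_lift f r = 1.
  by move=> [u [v [Euv ->]]]; rewrite gmulfM gmulfV /= (fE Euv) mulVg.
move=> /(normal_closure_hom relf); rewrite gmulfM gmulfV => /mulg1_eq.
by rewrite invgK.
Qed.

Lemma pres_liftM : {morph pres_lift fE : p q / p * q}.
Proof.
elim/pres_quotW=> a; elim/pres_quotW=> b.
by rewrite -[X in X * _]/(pres_proj E a) -pres_projM !pres_lift_pi gmulfM.
Qed.

Lemma pres_lift1 : pres_lift fE 1 = 1.
Proof. by rewrite (pres_lift_pi 1) gmulf1. Qed.

HB.instance Definition _ := isUMagmaMorphism.Build (presented E) G (pres_lift fE)
  (pres_lift1, pres_liftM).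

Lemma pres_lift_gen x : pres_lift fE (pgen E x) = f x.
Proof. by rewrite pres_lift_pi free_lift_gen. Qed.

End PresLift.

Lemma pres_hom_ext (X : Type) (E : free_group X -> free_group X -> Prop) (G : groupType)
    (f g : UMagmaMorphism.type (presented E) G) :
  (forall x, f (pgen E x) = g (pgen E x)) -> f =1 g.
Proof.
move=> fg; elim/pres_quotW=> a.
exact: (@free_hom_ext _ _ (f \o pres_proj E) (g \o pres_proj E)).
Qed.

Section FreeProduct.
Variables G H : groupType.

Inductive fprod_rel : free_group (G + H) -> free_group (G + H) -> Prop :=
| fprod_relL a b : fprod_rel (gen (inl a) * gen (inl b)) (gen (inl (a * b)))
| fprod_relR a b : fprod_rel (gen (inr a) * gen (inr b)) (gen (inr (a * b))).

Definition free_product : groupType := presented fprod_rel.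

Definition fprod_inl (a : G) : free_product := pgen fprod_rel (inl a).
Definition fprod_inr (a : H) : free_product := pgen fprod_rel (inr a).

Lemma fprod_inlM : {morph fprod_inl : a b / a * b}.
Proof. by move=> a b; rewrite [LHS](esym (pres_projE (fprod_relL a b))) gmulfM. Qed.
Lemma fprod_inrM : {morph fprod_inr : a b / a * b}.
Proof. by move=> a b; rewrite [LHS](esym (pres_projE (fprod_relR a b))) gmulfM. Qed.

Lemma fprod_inl1 : fprod_inl 1 = 1.
Proof. by apply: (@mulgI _ (fprod_inl 1)); rewrite -fprod_inlM !mulg1. Qed.
Lemma fprod_inr1 : fprod_inr 1 = 1.
Proof. by apply: (@mulgI _ (fprod_inr 1)); rewrite -fprod_inrM !mulg1. Qed.

HB.instance Definition _ := isUMagmaMorphism.Build G free_product fprod_inl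
  (fprod_inl1, fprod_inlM).
HB.instance Definition _ := isUMagmaMorphism.Build H free_product fprod_inr
  (fprod_inr1, fprod_inrM).

Section Lift.
Variables (K : groupType).
Variables (f : UMagmaMorphism.type G K) (g : UMagmaMorphism.type H K).

Definition fprod_val (s : G + H) : K :=
  match s with inl a => f a | inr b => g b end.

Lemma fprod_respects : respects fprod_rel fprod_val.
Proof. by move=> _ _ [] a b; rewrite gmulfM /= !free_lift_gen /= gmulfM. Qed.

Definition fprod_lift : free_product -> K := pres_lift fprod_respects.
HB.instance Definition _ := UMagmaMorphism.on fprod_lift.

Lemma fprod_lift_inl a : fprod_lift (fprod_inl a) = f a.
Proof. exact: pres_lift_gen. Qed.
Lemma fprod_lift_inr b : fprod_lift (fprod_inr b) = g b.
Proof. exact: pres_lift_gen. Qed.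

End Lift.

Lemma fprod_hom_ext (K : groupType) (f g : UMagmaMorphism.type free_product K) :
  (forall a, f (fprod_inl a) = g (fprod_inl a)) ->
  (forall b, f (fprod_inr b) = g (fprod_inr b)) -> f =1 g.
Proof. by move=> fgL fgR; apply: pres_hom_ext => -[]. Qed.

End FreeProduct.

Inductive abelian_rel (X : Type) : free_group X -> free_group X -> Prop :=
| abelian_comm x y : abelian_rel [~ gen x, gen y] 1.

Definition free_abelian (X : Type) : groupType := presented (@abelian_rel X).

Inductive raag_rel (S : finType) (e : rel S) :
    free_group S -> free_group S -> Prop :=
| raag_comm s t : e s t -> raag_rel e [~ gen s, gen t] 1.

Definition is_RAAG (G : groupType) : Prop :=
  exists (S : finType) (e : rel S), isomorphic (presented (raag_rel e)) G.

(* Automorphisms act on the right: in f * g, the factor f is applied first. *)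
Record aut (G : groupType) : Type := Aut {
  aut_fun :> G -> G;
  aut_morph : {morph aut_fun : a b / a * b};
  aut_bij : bijective aut_fun
}.

HB.instance Definition _ (G : groupType) := gen_eqMixin (aut G).
HB.instance Definition _ (G : groupType) := gen_choiceMixin (aut G).

Section AutGroup.
Variable G : groupType.
Implicit Types f g : aut G.

Lemma aut_ext f g : f =1 g -> f = g.
Proof.
case: f g => [f fM fB] [g gM gB] /= /funext fg; case: _ / fg in gM gB *.
by rewrite (Prop_irrelevance fM gM) (Prop_irrelevance fB gB).
Qed.

Definition aut_one : aut G :=
  @Aut G idfun (fun _ _ => erefl) (Bijective (frefl _) (frefl _)).

Lemma aut_mul_morph f g : {morph (g \o f) : a b / a * b}.
Proof. by move=> a b /=; rewrite !aut_morph. Qed.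

Definition aut_mul f g : aut G :=
  Aut (@aut_mul_morph f g) (bij_comp (aut_bij g) (aut_bij f)).

Lemma aut_inv_subproof f : {h : aut G | cancel f h /\ cancel h f}.
Proof.
apply: cid; case: (aut_bij f) => h fK hK.
have hM : {morph h : a b / a * b}.
  by move=> a b; apply: (bij_inj (aut_bij f)); rewrite aut_morph !hK.
by exists (Aut hM (Bijective hK fK)).
Qed.

Definition aut_inv f : aut G := sval (aut_inv_subproof f).

Lemma autK f : cancel f (aut_inv f).
Proof. exact: (svalP (aut_inv_subproof f)).1. Qed.
Lemma aut_invK f : cancel (aut_inv f) f.
Proof. exact: (svalP (aut_inv_subproof f)).2. Qed.

Lemma aut_mulA : associative aut_mul.
Proof. by move=> f g h; apply: aut_ext. Qed.
Lemma aut_mul1 : left_id aut_one aut_mul.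
Proof. by move=> f; apply: aut_ext. Qed.
Lemma aut_mulr1 : right_id aut_one aut_mul.
Proof. by move=> f; apply: aut_ext. Qed.
Lemma aut_mulV : left_inverse aut_one aut_inv aut_mul.
Proof. by move=> f; apply: aut_ext => a; apply: aut_invK. Qed.
Lemma aut_mulrV : right_inverse aut_one aut_inv aut_mul.
Proof. by move=> f; apply: aut_ext => a; apply: autK. Qed.

HB.instance Definition _ := isGroup.Build (aut G)
  aut_mulA aut_mul1 aut_mulr1 aut_mulV aut_mulrV.

Definition aut_of (f g : UMagmaMorphism.type G G)
    (fK : cancel f g) (gK : cancel g f) : aut G :=
  Aut (@gmulfM _ _ f) (Bijective fK gK).

End AutGroup.

Inductive vb2_gen := Sigma1 | Rho1.

Inductive vb2_rel : free_group vb2_gen -> free_group vb2_gen -> Prop :=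
| rho1_sqr : vb2_rel (gen Rho1 ^+ 2) 1.

Definition VB2 : groupType := presented vb2_rel.
Definition sigma1 : VB2 := pgen vb2_rel Sigma1.
Definition rho1 : VB2 := pgen vb2_rel Rho1.

(* The virtual Hopf link is the closure of this braid. *)
Definition virtual_hopf : VB2 := sigma1^-1 * rho1.

Section RepresentationA.

Inductive genA := X1 | X2 | Y.
Definition F3 : groupType := free_group genA.
Local Notation x1 := (gen X1 : F3).
Local Notation x2 := (gen X2 : F3).
Local Notation y := (gen Y : F3).

Definition sigmaA_img (s : genA) : F3 :=
  match s with X1 => x1 * x2 * x1^-1 | X2 => x1 | Y => y end.
Definition sigmaA_inv_img (s : genA) : F3 :=
  match s with X1 => x2 | X2 => x2^-1 * x1 * x2 | Y => y end.
Definition rhoA_img (s : genA) : F3 :=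
  match s with X1 => x2 ^ y^-1 | X2 => x1 ^ y | Y => y end.

Lemma free_lift_can (X : Type) (f g : X -> free_group X) :
  (forall x, free_lift g (f x) = gen x) -> cancel (free_lift f) (free_lift g).
Proof.
move=> gf; apply: (@free_hom_ext _ _ (free_lift g \o free_lift f) idfun) => x /=.
by rewrite free_lift_gen gf.
Qed.

Lemma sigmaA_can : cancel (free_lift sigmaA_img) (free_lift sigmaA_inv_img).
Proof.
apply: free_lift_can => -[] /=; rewrite ?gmulfM ?gmulfV /= !free_lift_gen //=.
by rewrite !mulgA mulgV mul1g mulgK.
Qed.
Lemma sigmaA_inv_can : cancel (free_lift sigmaA_inv_img) (free_lift sigmaA_img).
Proof.
apply: free_lift_can => -[] /=; rewrite ?gmulfM ?gmulfV /= !free_lift_gen //=.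
by rewrite !mulgA mulVg mul1g mulgVK.
Qed.
Lemma rhoA_can : cancel (free_lift rhoA_img) (free_lift rhoA_img).
Proof.
apply: free_lift_can => -[] /=; rewrite ?gmulfJ ?gmulfV /= !free_lift_gen //=.
  exact: conjgK.
exact: conjgKV.
Qed.

Definition phiA_img (s : vb2_gen) : aut F3 :=
  match s with
  | Sigma1 => aut_of sigmaA_can sigmaA_inv_can
  | Rho1 => aut_of rhoA_can rhoA_can
  end.

Lemma phiA_respects : respects vb2_rel phiA_img.
Proof.
move=> _ _ []; rewrite expg2 gmulfM gmulf1 /= free_lift_gen.
by apply: aut_ext => a; apply: rhoA_can.
Qed.

Definition phiA : VB2 -> aut F3 := pres_lift phiA_respects.
HB.instance Definition _ := UMagmaMorphism.on phiA.

Inductive linkA_rel (beta : VB2) : F3 -> F3 -> Prop :=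
| linkA_x1 : linkA_rel beta x1 (phiA beta x1)
| linkA_x2 : linkA_rel beta x2 (phiA beta x2).

(* The group of the link closing beta; likewise G_M below. *)
Definition G_A (beta : VB2) : groupType := presented (linkA_rel beta).

End RepresentationA.

Section RepresentationM.

Inductive genY := Y1 | Y2.
Inductive genV := V1 | V2.

Definition F2 : groupType := free_group genY.
Definition Z2 : groupType := free_abelian genV.
Definition F22 : groupType := free_product F2 Z2.

Definition f22_y (i : genY) : F22 := fprod_inl Z2 (gen i).
Definition f22_v (i : genV) : F22 := fprod_inr F2 (pgen (@abelian_rel genV) i).

Local Notation y1 := (f22_y Y1).
Local Notation y2 := (f22_y Y2).
Local Notation v1 := (f22_v V1).
Local Notation v2 := (f22_v V2).

Lemma f22_v_comm i j : [~ f22_v i, f22_v j] = 1.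
Proof.
rewrite -[RHS](fprod_inr1 F2 Z2) -[LHS]gmulfR; congr (fprod_inr F2 _).
by have := pres_projE (abelian_comm i j); rewrite gmulfR gmulf1.
Qed.

Definition swapV (i : genV) : genV := match i with V1 => V2 | V2 => V1 end.

Lemma swapV_respects : respects (@abelian_rel genV) (f22_v \o swapV).
Proof.
move=> _ _ [i j]; rewrite gmulfR gmulf1 /= !free_lift_gen.
exact: f22_v_comm.
Qed.

(* The endomorphism of F_{2,2} with y_i |-> f i and v_1 <-> v_2. *)
Definition endM (f : genY -> F22) : F22 -> F22 :=
  fprod_lift (free_lift f) (pres_lift swapV_respects).
HB.instance Definition _ f := UMagmaMorphism.on (endM f).

Lemma endM_y f i : endM f (f22_y i) = f i.
Proof. by rewrite /endM /f22_y fprod_lift_inl /= free_lift_gen. Qed.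
Lemma endM_v f i : endM f (f22_v i) = f22_v (swapV i).
Proof. by rewrite /endM /f22_v fprod_lift_inr /= pres_lift_gen. Qed.

Lemma F22_hom_ext (K : groupType) (f g : UMagmaMorphism.type F22 K) :
  (forall i, f (f22_y i) = g (f22_y i)) ->
  (forall i, f (f22_v i) = g (f22_v i)) -> f =1 g.
Proof.
move=> fgy fgv; apply: fprod_hom_ext.
  exact: (@free_hom_ext _ _ (f \o @fprod_inl F2 Z2) (g \o @fprod_inl F2 Z2)).
exact: (@pres_hom_ext _ _ _ (f \o @fprod_inr F2 Z2) (g \o @fprod_inr F2 Z2)).
Qed.

Lemma endM_can f g : (forall i, endM g (f i) = f22_y i) ->
  cancel (endM f) (endM g).
Proof.
move=> gf; apply: (@F22_hom_ext _ (endM g \o endM f) idfun) => i /=.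
  by rewrite endM_y.
by rewrite !endM_v; case: i.
Qed.

Definition sigmaM_img (i : genY) : F22 :=
  match i with Y1 => y1 * y2 * y1^-1 | Y2 => y1 end.
Definition sigmaM_inv_img (i : genY) : F22 :=
  match i with Y1 => y2 | Y2 => y2^-1 * y1 * y2 end.
Definition rhoM_img (i : genY) : F22 :=
  match i with Y1 => y2 ^ v1^-1 | Y2 => y1 ^ v2 end.

Lemma sigmaM_can : cancel (endM sigmaM_img) (endM sigmaM_inv_img).
Proof.
apply: endM_can => -[] /=; rewrite ?gmulfM ?gmulfV /= !endM_y //=.
by rewrite !mulgA mulgV mul1g mulgK.
Qed.
Lemma sigmaM_inv_can : cancel (endM sigmaM_inv_img) (endM sigmaM_img).
Proof.
apply: endM_can => -[] /=; rewrite ?gmulfM ?gmulfV /= !endM_y //=.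
by rewrite !mulgA mulVg mul1g mulgVK.
Qed.
Lemma rhoM_can : cancel (endM rhoM_img) (endM rhoM_img).
Proof.
apply: endM_can => -[] /=; rewrite ?gmulfJ ?gmulfV /= endM_y endM_v /=.
  exact: conjgK.
exact: conjgKV.
Qed.

Definition phiM_img (s : vb2_gen) : aut F22 :=
  match s with
  | Sigma1 => aut_of sigmaM_can sigmaM_inv_can
  | Rho1 => aut_of rhoM_can rhoM_can
  end.

Lemma phiM_respects : respects vb2_rel phiM_img.
Proof.
move=> _ _ []; rewrite expg2 gmulfM gmulf1 /= free_lift_gen.
by apply: aut_ext => a; apply: rhoM_can.
Qed.

Definition phiM : VB2 -> aut F22 := pres_lift phiM_respects.
HB.instance Definition _ := UMagmaMorphism.on phiM.

Definition f22_gen (s : genY + genV) : F22 :=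
  match s with inl i => f22_y i | inr i => f22_v i end.

(* The image phiM(beta)(s) of a generator s is an element of F_{2,2}; as a side
   of a relation it stands for any word w on y_1, y_2, v_1, v_2 representing it.
   Two such words agree modulo [v_1, v_2] = 1, so listing them all does not
   change the presented group. *)
Inductive linkM_rel (beta : VB2) :
    free_group (genY + genV) -> free_group (genY + genV) -> Prop :=
| linkM_comm : linkM_rel beta [~ gen (inr V1), gen (inr V2)] 1
| linkM_gen s w : free_lift f22_gen w = phiM beta (f22_gen s) ->
    linkM_rel beta (gen s) w.

Definition G_M (beta : VB2) : groupType := presented (linkM_rel beta).

End RepresentationM.

(* Main.v *)
Require Import Defs.
From HB Require Import structures.
From mathcomp Require Import all_boot zmodp.

(** For beta = sigma_1^-1 rho_1 the relations of G_A say that x_1 commutes with y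
    and that x_2 commutes with x_1^-1 y.  Replacing y by z = x_1^-1 y gives the
    right-angled Artin group of the path x_1 - z - x_2.  Likewise, replacing v_1
    by w = y_1^-1 v_1 turns G_M into the right-angled Artin group of the path
    y_1 - v_2 - w - y_2.  The number of generators of a right-angled Artin group
    is an isomorphism invariant, because there are exactly 2^n homomorphisms from
    a group with n such generators to Z/2. *)

Set Implicit Arguments.
Unset Strict Implicit.
Unset Printing Implicit Defensive.

Local Open Scope group_scope.

(** * Isomorphisms of groups, and commutation written as conjugation *)

Section Groups.
Implicit Types G H K : groupType.

(** Cancelling in [f 1 * f 1 = f 1] gives [f 1 = 1], so a multiplicative bijection can be repackaged
    as a unital morphism. *)
Lemma isomorphicP G H :
  isomorphic G H <-> exists f : UMagmaMorphism.type G H, bijective f.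
Proof.
split=> [[f fB]|[f fB]]; last by exists f.
have f1 : f 1 = 1 by apply: (@mulgI _ (f 1)); rewrite -gmulfM !mulg1.
pose fm := isUMagmaMorphism.Build G H f (f1, @gmulfM _ _ f).
by exists (HB.pack_for (UMagmaMorphism.type G H) (f : G -> H) fm).
Qed.

Lemma isomorphic_sym G H : isomorphic G H -> isomorphic H G.
Proof.
move=> /isomorphicP [f [g fK gK]]; apply/isomorphicP.
have f_inj := can_inj fK.
have g1 : g 1 = 1 by apply: f_inj; rewrite gK gmulf1.
have gM : {morph g : a b / a * b} by move=> a b; apply: f_inj; rewrite gmulfM !gK.
pose gm := isUMagmaMorphism.Build H G g (g1, gM).
by exists (HB.pack_for (UMagmaMorphism.type H G) g gm), f.
Qed.

Lemma isomorphic_trans G H K : isomorphic G H -> isomorphic H K -> isomorphic G K.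
Proof. by move=> [f fB] [g gB]; exists (g \o f); apply: bij_comp. Qed.

Lemma conjg_commute G (a b : G) : a = a ^ b <-> commute a b.
Proof.
split=> [ab|ab]; last by apply/esym/conjg_fixP/commgP.
exact/commgP/conjg_fixP/esym.
Qed.

(** The right side is [b] conjugated by [c^-1 * a], whose inverse is [a^-1 * c]. The relations for
    [x_2] and [y_2] take this shape. *)
Lemma conjg_divg_commute G (a b c : G) :
  b = (b ^ c^-1) ^ a <-> commute (a^-1 * c) b.
Proof.
rewrite -conjgM conjg_commute -[_ * a]invgK invgM invgK.
split=> [/commuteV|cb]; first by rewrite invgK; apply: commute_sym.
exact/commuteV/commute_sym.
Qed.

End Groups.

(** * Maps between presented groups *)

Lemma pgen_respects (X : Type) E : respects E (pgen E : X -> presented E).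
Proof.
suff E1 a : free_lift (pgen E) a = pres_proj E a.
  by move=> u v /pres_projE; rewrite !E1.
apply: (@free_hom_ext _ _ (free_lift (pgen E)) (pres_proj E)) => x.
exact: free_lift_gen.
Qed.

Lemma presented_isomorphic (X X' : Type) E E'
    (f : X -> presented E') (g : X' -> presented E)
    (fE : respects E f) (gE : respects E' g) :
  (forall x, pres_lift gE (f x) = pgen E x) ->
  (forall x, pres_lift fE (g x) = pgen E' x) ->
  isomorphic (presented E) (presented E').
Proof.
move=> gf fg; exists (pres_lift fE); exists (pres_lift gE).
  apply: (@pres_hom_ext _ _ _ (pres_lift gE \o pres_lift fE) idfun) => x /=.
  by rewrite pres_lift_gen gf.
apply: (@pres_hom_ext _ _ _ (pres_lift fE \o pres_lift gE) idfun) => x /=.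
by rewrite pres_lift_gen fg.
Qed.

(** The inverse in [aut G] is obtained by choice, so it has to be identified with the explicit
    inverse [g]. *)
Lemma aut_ofV (G : groupType) (f g : UMagmaMorphism.type G G)
    (fK : cancel f g) (gK : cancel g f) : (aut_of fK gK)^-1 =1 g.
Proof. by move=> a; rewrite -{2}[a](aut_invK (aut_of fK gK)) /= fK. Qed.

(** * Right-angled Artin groups and their number of generators *)

Section RightAngledArtin.
Variables (S : finType) (e : rel S).

Lemma raag_respects (G : groupType) (f : S -> G) :
  (forall s t, e s t -> commute (f s) (f t)) -> respects (raag_rel e) f.
Proof.
move=> fC _ _ [s t est]; rewrite gmulfR gmulf1 /= !free_lift_gen.
exact/eqP/commgP/fC.
Qed.

Lemma raag_gen_commute s t :
  e s t -> commute (pgen (raag_rel e) s) (pgen (raag_rel e) t).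
Proof.
move=> /raag_comm/pres_projE; rewrite gmulfR gmulf1 => /eqP; exact: commgP.
Qed.

End RightAngledArtin.

(** Every map from [S'] to Z/2 extends to a homomorphism. Pulling back along the surjection [f] is
    injective, whence 2^|S'| <= 2^|S|. *)
Lemma raag_card_le (S S' : finType) (e : rel S) (e' : rel S') :
  isomorphic (presented (raag_rel e)) (presented (raag_rel e')) -> #|S'| <= #|S|.
Proof.
move=> /isomorphicP [f [g _ gK]].
have chiE (t : {ffun S' -> 'Z_2}) : respects (raag_rel e') t.
  by apply: raag_respects => s s' _; apply: Zp_mulgC.
pose restr (t : {ffun S' -> 'Z_2}) : {ffun S -> 'Z_2} :=
  [ffun s => pres_lift (chiE t) (f (pgen (raag_rel e) s))].
have restr_inj : injective restr.
  move=> t t' /ffunP tt'; apply/ffunP=> s.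
  (* Writing the generator as [f (g _)] reduces the claim to the two pullbacks, which agree on the
     generators indexed by [S]. *)
  rewrite -(pres_lift_gen (chiE t)) -(pres_lift_gen (chiE t')) -[pgen _ s]gK.
  apply: (@pres_hom_ext _ _ _ (pres_lift (chiE t) \o f) (pres_lift (chiE t') \o f)).
  by move=> x; have := tt' x; rewrite !ffunE.
by have := leq_card _ restr_inj; rewrite !card_ffun card_ord leq_exp2l.
Qed.

Lemma raag_card (S S' : finType) (e : rel S) (e' : rel S') :
  isomorphic (presented (raag_rel e)) (presented (raag_rel e')) -> #|S| = #|S'|.
Proof.
move=> ee'; apply/eqP; rewrite eqn_leq (raag_card_le ee').
by rewrite (raag_card_le (isomorphic_sym ee')).
Qed.

(** Each edge is listed in one direction only; commutation is symmetric. *)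
Definition path_graph (n : nat) : rel 'I_n := fun i j => i.+1 == j.

Lemma path_raag_respects (G : groupType) n (f : nat -> G) :
  (forall i, i.+1 < n -> commute (f i) (f i.+1)) ->
  respects (raag_rel (@path_graph n)) (fun i => f i).
Proof.
move=> fC; apply: raag_respects => i j /eqP ij; rewrite -ij.
by apply: fC; rewrite ij.
Qed.

(** The path has [n.+1] vertices, numbered from 0 to [n]; [inord] allows numerals as indices. *)
Local Notation path_gen n i := (pgen (raag_rel (@path_graph n.+1)) (inord i)).

Lemma path_genE n (i : 'I_n.+1) : path_gen n i = pgen (raag_rel (@path_graph n.+1)) i.
Proof. by rewrite inord_val. Qed.

Lemma path_gen_commute n i : i < n -> commute (path_gen n i) (path_gen n i.+1).
Proof.
move=> ltin; apply: raag_gen_commute.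
by rewrite /path_graph !inordK // ltnS ltnW.
Qed.

(** * The group [G_A] of the virtual Hopf link *)

Section GroupA.

Lemma phiA_hopf a :
  phiA virtual_hopf a = free_lift rhoA_img (free_lift sigmaA_inv_img a).
Proof.
have phiA_gen s : phiA (pgen vb2_rel s) = phiA_img s by apply: pres_lift_gen.
rewrite /virtual_hopf gmulfM gmulfV /= !phiA_gen /=.
by congr (free_lift _ _); apply: aut_ofV.
Qed.

(** The braid sends [x_1] to [x_1^y] and [x_2] to [x_2^(y^-1)] conjugated by [x_1^y]. The first
    relation replaces this last [x_1^y] by [x_1]. *)
Lemma linkA_hopf_respects (G : groupType) (f : genA -> G) :
  respects (linkA_rel virtual_hopf) f <->
  commute (f X1) (f Y) /\ commute ((f X1)^-1 * f Y) (f X2).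
Proof.
have fx1 : free_lift f (phiA virtual_hopf (gen X1)) = f X1 ^ f Y.
  by rewrite phiA_hopf free_lift_gen /= free_lift_gen /= gmulfJ /= !free_lift_gen.
have fx2 : free_lift f (phiA virtual_hopf (gen X2)) = (f X2 ^ (f Y)^-1) ^ (f X1 ^ f Y).
  rewrite phiA_hopf free_lift_gen /= -mulgA -conjgE !gmulfJ /= !free_lift_gen /=.
  by rewrite !gmulfJ gmulfV /= !free_lift_gen.
have twistE : commute (f X1) (f Y) ->
    f X2 = (f X2 ^ (f Y)^-1) ^ (f X1 ^ f Y) <-> commute ((f X1)^-1 * f Y) (f X2).
  by move=> /conjg_commute <-; apply: conjg_divg_commute.
split=> [fE|[xy xyz]].
  have := fE _ _ (linkA_x1 _); rewrite fx1 free_lift_gen => /conjg_commute xy.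
  by have := fE _ _ (linkA_x2 _); rewrite fx2 free_lift_gen => /(twistE xy).
move=> _ _ []; rewrite ?fx1 ?fx2 free_lift_gen; first exact/conjg_commute.
exact/twistE.
Qed.

Local Notation GA := (G_A virtual_hopf).
Local Notation gA := (pgen (linkA_rel virtual_hopf)).

Definition pathA_gen (i : nat) : GA :=
  nth 1 [:: gA X1; (gA X1)^-1 * gA Y; gA X2] i.

Definition pathA_inv (s : genA) : presented (raag_rel (@path_graph 3)) :=
  match s with
  | X1 => path_gen 2 0
  | X2 => path_gen 2 2
  | Y => path_gen 2 0 * path_gen 2 1
  end.

Lemma pathA_gen_respects : respects (raag_rel (@path_graph 3)) (fun i => pathA_gen i).
Proof.
have [xy xyz] := (linkA_hopf_respects gA).1 (@pgen_respects _ _).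
apply: path_raag_respects => -[|[|i]] //= _.
by apply: commuteM => //; apply: commuteV.
Qed.

Lemma pathA_inv_respects : respects (linkA_rel virtual_hopf) pathA_inv.
Proof.
(* Since [y] goes to [x_1 z], the element [x_1^-1 y] goes to [z]. *)
apply/linkA_hopf_respects; rewrite /= mulKg; split; last exact: path_gen_commute.
by apply: commuteM; [|apply: path_gen_commute].
Qed.

Lemma G_A_hopf_path : isomorphic (presented (raag_rel (@path_graph 3))) GA.
Proof.
apply: (presented_isomorphic (fE := pathA_gen_respects) (gE := pathA_inv_respects)).
  (* Passing to the [inord] form matches the numerals in [pathA_inv]. *)
  move=> i; rewrite -path_genE; case: i => -[|[|[|i]]] //= _; rewrite /pathA_gen /=.
  - exact: pres_lift_gen.
  - by rewrite gmulfM gmulfV /= !pres_lift_gen mulKg.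
  - exact: pres_lift_gen.
by case=> /=; rewrite ?gmulfM /= !pres_lift_gen /pathA_gen !inordK //= mulVKg.
Qed.

End GroupA.

(** * The group [G_M] of the virtual Hopf link *)

Section GroupM.

Lemma phiM_hopf a : phiM virtual_hopf a = endM rhoM_img (endM sigmaM_inv_img a).
Proof.
have phiM_gen s : phiM (pgen vb2_rel s) = phiM_img s by apply: pres_lift_gen.
rewrite /virtual_hopf gmulfM gmulfV /= !phiM_gen /=.
by congr (endM _ _); apply: aut_ofV.
Qed.

(** This is the universal property of the free product of F_2 and Z^2. *)
Lemma F22_lift (G : groupType) (f : genY + genV -> G) :
  commute (f (inr V1)) (f (inr V2)) ->
  exists h : UMagmaMorphism.type F22 G, forall s, h (f22_gen s) = f s.
Proof.
move=> vC; have fE : respects (@abelian_rel genV) (f \o inr).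
  move=> _ _ [i j]; rewrite gmulfR gmulf1 /= !free_lift_gen.
  (* [abelian_rel] ranges over all ordered pairs, including equal and reversed ones. *)
  by apply/eqP/commgP; case: i; case: j => //=; apply: commute_sym.
exists (fprod_lift (free_lift (f \o inl)) (pres_lift fE)) => -[i|i] /=.
  by rewrite /f22_y fprod_lift_inl /= free_lift_gen.
by rewrite /f22_v fprod_lift_inr /= pres_lift_gen.
Qed.

Local Notation y1 := (inl Y1).
Local Notation y2 := (inl Y2).
Local Notation v1 := (inr V1).
Local Notation v2 := (inr V2).

(** One representing word for each image. Both braid letters swap [v_1] and [v_2], so these return
    to themselves. *)
Definition phiM_hopf_word (s : genY + genV) : free_group (genY + genV) :=
  match s with
  | inl Y1 => gen y1 ^ gen v2
  | inl Y2 => (gen y2 ^ (gen v1)^-1) ^ (gen y1 ^ gen v2)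
  | inr i => gen (inr i)
  end.

Lemma phiM_hopf_wordE s :
  free_lift f22_gen (phiM_hopf_word s) = phiM virtual_hopf (f22_gen s).
Proof.
rewrite phiM_hopf; case: s => -[] /=.
- by rewrite gmulfJ /= !free_lift_gen !endM_y.
- rewrite !gmulfJ gmulfV /= !free_lift_gen endM_y /= -mulgA -conjgE !gmulfJ /=.
  by rewrite !endM_y.
- by rewrite free_lift_gen /= !endM_v.
- by rewrite free_lift_gen /= !endM_v.
Qed.

(** As for [G_A], with the role of [y] split: [v_2] conjugates [y_1], and [v_1] enters through
    [y_1^-1 v_1]. *)
Lemma linkM_hopf_respects (G : groupType) (f : genY + genV -> G) :
  respects (linkM_rel virtual_hopf) f <->
  [/\ commute (f v1) (f v2), commute (f y1) (f v2)
    & commute ((f y1)^-1 * f v1) (f y2)].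
Proof.
have fy1 : free_lift f (phiM_hopf_word y1) = f y1 ^ f v2.
  by rewrite gmulfJ /= !free_lift_gen.
have fy2 : free_lift f (phiM_hopf_word y2) = (f y2 ^ (f v1)^-1) ^ (f y1 ^ f v2).
  by rewrite !gmulfJ gmulfV /= !free_lift_gen.
have twistE : commute (f y1) (f v2) ->
    f y2 = (f y2 ^ (f v1)^-1) ^ (f y1 ^ f v2) <-> commute ((f y1)^-1 * f v1) (f y2).
  by move=> /conjg_commute <-; apply: conjg_divg_commute.
split=> [fE|[vC yv yw]].
  have fC := fE _ _ (linkM_comm _).
  have fgen s := fE _ _ (linkM_gen (phiM_hopf_wordE s)).
  have := fgen y1; rewrite fy1 free_lift_gen => /conjg_commute yv.
  have := fgen y2; rewrite fy2 free_lift_gen => /(twistE yv) yw; split=> //.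
  by move: fC; rewrite gmulfR gmulf1 /= !free_lift_gen => /eqP/commgP.
(* The relations involve every word [w] representing an image. Factoring through F_{2,2} shows that
   its value depends only on the element represented. *)
have [h hE] := F22_lift vC.
have hw w : h (free_lift f22_gen w) = free_lift f w.
  apply: (@free_hom_ext _ _ (h \o free_lift f22_gen) (free_lift f)) => s /=.
  by rewrite !free_lift_gen.
move=> _ _ [|s w wE].
  by rewrite gmulfR gmulf1 /= !free_lift_gen; apply/eqP/commgP.
rewrite -(hw w) wE -phiM_hopf_wordE hw free_lift_gen.
case: s {w wE} => -[].
- by rewrite fy1; apply/conjg_commute.
- by rewrite fy2; apply/twistE.
- by rewrite free_lift_gen.
- by rewrite free_lift_gen.
Qed.

Local Notation GM := (G_M virtual_hopf).
Local Notation gM := (pgen (linkM_rel virtual_hopf)).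

Definition pathM_gen (i : nat) : GM :=
  nth 1 [:: gM y1; gM v2; (gM y1)^-1 * gM v1; gM y2] i.

Definition pathM_inv (s : genY + genV) : presented (raag_rel (@path_graph 4)) :=
  match s with
  | inl Y1 => path_gen 3 0
  | inl Y2 => path_gen 3 3
  | inr V1 => path_gen 3 0 * path_gen 3 2
  | inr V2 => path_gen 3 1
  end.

Lemma pathM_gen_respects : respects (raag_rel (@path_graph 4)) (fun i => pathM_gen i).
Proof.
have [vC yv yw] := (linkM_hopf_respects gM).1 (@pgen_respects _ _).
apply: path_raag_respects => -[|[|[|i]]] //= _.
(* The remaining edge is the middle one: [v_2] commutes with both factors of [y_1^-1 v_1]. *)
apply: commuteM; last exact: commute_sym.
by apply/commuteV/commute_sym.
Qed.

Lemma pathM_inv_respects : respects (linkM_rel virtual_hopf) pathM_inv.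
Proof.
apply/linkM_hopf_respects; rewrite /= mulKg; split; try exact: path_gen_commute.
(* Here [v_1] is [y_1 w], and both [y_1] and [w] are neighbours of [v_2] in the path. *)
by apply/commute_sym/commuteM; [apply/commute_sym|]; apply: path_gen_commute.
Qed.

Lemma G_M_hopf_path : isomorphic (presented (raag_rel (@path_graph 4))) GM.
Proof.
apply: (presented_isomorphic (fE := pathM_gen_respects) (gE := pathM_inv_respects)).
  move=> i; rewrite -path_genE; case: i => -[|[|[|[|i]]]] //= _; rewrite /pathM_gen /=.
  - exact: pres_lift_gen.
  - exact: pres_lift_gen.
  - by rewrite gmulfM gmulfV /= !pres_lift_gen mulKg.
  - exact: pres_lift_gen.
by case=> -[] /=; rewrite ?gmulfM /= !pres_lift_gen /pathM_gen !inordK //= mulVKg.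
Qed.

End GroupM.

Theorem proposition5p1 :
  is_RAAG (G_A virtual_hopf) /\ is_RAAG (G_M virtual_hopf) /\
  ~ isomorphic (G_A virtual_hopf) (G_M virtual_hopf).
Proof.
have [isoA isoM] := (G_A_hopf_path, G_M_hopf_path).
split; [by exists 'I_3, (@path_graph 3)|split; [by exists 'I_4, (@path_graph 4)|]].
(* An isomorphism would identify the groups of the paths on 3 and 4 vertices, forcing 3 = 4. *)
move=> AM; have /raag_card : isomorphic (presented (raag_rel (@path_graph 3)))
    (presented (raag_rel (@path_graph 4))).
  exact: isomorphic_trans isoA (isomorphic_trans AM (isomorphic_sym isoM)).
by rewrite !card_ord.
Qed.
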